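(* Let $\mathbf A\in\mathbb C^{n\times n}$ and $\mathbf B\in\mathbb C^{m\times m}$ be diagonalizable and let $\mathbf C\in\mathbb C^{m\times n}$. Let $\Xi=\{\alpha+e^{i\theta}t: t\in\mathbb R\}$ (with $\alpha\in\mathbb C$, $\theta\in\mathbb R$) be a line in the complex plane, and let $H_{\mathbf A},H_{\mathbf B}$ be the two open half-planes separated by $\Xi$, where $\sigma(\mathbf A)\subset H_{\mathbf A}$ and $\sigma(\mathbf B)\subset H_{\mathbf B}$. Define $\operatorname{sign}:\mathbb C\setminus\Xi\to\mathbb C$ by $\operatorname{sign}(z)=1$ for $z\in H_{\mathbf A}$ and $\operatorname{sign}(z)=-1$ for $z\in H_{\mathbf B}$. Let $\Sigma=\bigcup_{j=1}^{g+1}[\beta_j,\gamma_j]\subset\mathbb R$ be a finite union of disjoint intervals ($\beta_j<\gamma_j$) such that $\Xi\cap\Sigma=\emptyset$ and such that $\sigma(\mathbf A)$ and $\sigma(\mathbf B)$ are contained in the interior of $\Sigma$. Let $w$ be an admissible weight function on $\Sigma$ (see context), with orthonormal polynomials $(p_j)_{j=0}^\infty$. Then the solution $\mathbf X\in\mathbb C^{m\times n}$ of the Sylvester equation $\mathbf X\mathbf A-\mathbf B\mathbf X=\mathbf C$ is given by the convergent series $$\mathbf X=\frac12\sum_{j=0}^\infty\alpha_j\,p_j(\mathbf H)_{n+1:n+m,\,1:n},\qquad \mathbf H=\begin{pmatrix}\mathbf A&\mathbf 0\\ \mathbf C&\mathbf B\end{pmatrix},\qquad \alpha_j=\int_\S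igma\operatorname{sign}(x)\,p_j(x)\,w(x)\,dx.$$
   Context: $\sigma(\cdot)$ denotes the set of eigenvalues. For a matrix $\mathbf N\in\mathbb C^{(n+m)\times(n+m)}$, $\mathbf N_{n+1:n+m,1:n}$ is its lower-left $m\times n$ block (rows $n+1,\dots,n+m$, columns $1,\dots,n$). Admissible weight function: a nonnegative function $w$ supported on $\Sigma$, continuous and positive on the interior of $\Sigma$, normalized by $\int_\Sigma w(x)\,dx=1$, of the form $$w(x)=\sum_{j=1}^{g+1}\mathbf 1_{[\beta_j,\gamma_j]}(x)\,h_j(x)\left(\sqrt{x-\beta_j}\right)^{c_j}\left(\sqrt{\gamma_j-x}\right)^{d_j},\qquad c_j,d_j\in\{-1,1\},$$ where each $h_j$ is positive on $[\beta_j,\gamma_j]$ and has an analytic extension to a neighborhood of $[\beta_j,\gamma_j]$. The orthonormal polynomials $(p_j)_{j\ge0}$ for $w$ are the polynomials with $\deg p_j=j$ and positive leading coefficient satisfying $\int_\Sigma p_j(x)p_k(x)w(x)\,dx=\delta_{jk}$. *)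

(* Defs.v *)
From HB Require Import structures.
From mathcomp Require Export all_boot all_order all_algebra.
From mathcomp Require Export complex.
From mathcomp Require Export all_classical all_reals all_analysis.

Set Implicit Arguments.
Unset Strict Implicit.
Unset Printing Implicit Defensive.

Import Order.TTheory GRing.Theory Num.Theory.
Import numFieldNormedType.Exports.

Local Open Scope classical_set_scope.
Local Open Scope ring_scope.
Local Open Scope complex_scope.

(* MathComp-Analysis attaches the modulus topology to an abstract numFieldType
   only; it is transported to the concrete type R[i] (and hence to matrices
   over it). *)
HB.instance Definition _ (R : rcfType) := NormedModule.copy R[i] (R[i])^o.

Section Spectrum.
Context {R : realType}.

Definition spectrum k (A : 'M[R[i]]_k) : set R[i] := [set z | eigenvalue A z].

Definition direction (theta : R) : R[i] := cos theta +i* sin theta.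

Definition line (alpha : R[i]) (theta : R) : set R[i] :=
  [set alpha + direction theta * t%:C | t in [set: R]].

(* [half_plane alpha theta false] lies to the left of the oriented line
   [line alpha theta], [half_plane alpha theta true] to its right. *)
Definition half_plane (alpha : R[i]) (theta : R) (side : bool) : set R[i] :=
  [set z | 0 < (-1) ^+ side * complex.Im ((z - alpha) / direction theta)].

End Spectrum.

Section Weight.
Context {R : realType}.

Definition intervals_union g (beta gamma : 'I_g.+1 -> R) : set R :=
  \bigcup_(j in [set: 'I_g.+1]) `[beta j, gamma j]%classic.

Definition complex_analytic_on (U : set R[i]) (f : R[i] -> R[i]) : Prop :=
  forall z0, U z0 -> exists (a : nat -> R[i]) (r : R), 0 < r /\
    forall z, `|z - z0| < r%:C ->
      series (fun k => a k * (z - z0) ^+ k) @ \oo --> f z.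

Definition has_analytic_extension (D : set R) (h : R -> R) : Prop :=
  exists (U : set R[i]) (f : R[i] -> R[i]),
    [/\ open U,
        [set x%:C | x in D] `<=` U,
        complex_analytic_on U f &
        forall x, D x -> f x%:C = (h x)%:C].

(* Since 0^-1 = 0, a factor with exponent -1 makes [w] take the value 0, rather
   than +oo, at the corresponding endpoint; this affects no integral against
   [w]. *)
Record admissible_weight g (beta gamma : 'I_g.+1 -> R) (w : R -> R) : Prop := {
  weight_ge0 : forall x, 0 <= w x ;
  weight_support : forall x, ~ intervals_union beta gamma x -> w x = 0 ;
  weight_continuous :
    forall x, (intervals_union beta gamma)° x -> {for x, continuous w} ;
  weight_gt0 : forall x, (intervals_union beta gamma)° x -> 0 < w x ;
  weight_normalized :
    \int[lebesgue_measure]_(x in intervals_union beta gamma) w x = 1 ;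
  weight_form : exists (h : 'I_g.+1 -> R -> R) (c d : 'I_g.+1 -> int),
    [/\ forall j, c j \in [:: -1; 1] /\ d j \in [:: -1; 1],
        forall j x, x \in `[beta j, gamma j] -> 0 < h j x,
        forall j, has_analytic_extension `[beta j, gamma j]%classic (h j) &
        forall x, w x = \sum_(j < g.+1)
          \1_(`[beta j, gamma j]%classic) x * h j x
            * Num.sqrt (x - beta j) ^ c j * Num.sqrt (gamma j - x) ^ d j]
}.

Record orthonormal_polynomials (S : set R) (w : R -> R) (p : nat -> {poly R})
    : Prop := {
  orthonormal_size : forall j, size (p j) = j.+1 ;
  orthonormal_lead_gt0 : forall j, 0 < lead_coef (p j) ;
  orthonormal_integral : forall j k,
    \int[lebesgue_measure]_(x in S) ((p j).[x] * (p k).[x] * w x)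
      = (j == k)%:R
}.

(* [sgn] is a function on the complex plane, real-valued because it only takes
   the values 1 and -1 off the line; only its restriction to the real axis is
   integrated. *)
Definition sign_coef (S : set R) (w : R -> R) (p : nat -> {poly R})
    (sgn : R[i] -> R) (j : nat) : R :=
  \int[lebesgue_measure]_(x in S) (sgn x%:C * (p j).[x] * w x).

End Weight.

Section Blocks.
Context {R : realType} {n m : nat}.

(* [horner_mx] needs a size in successor form: [(n + m.+1).+1] is convertible to
   [n.+1 + m.+1], where [n.+1] and [m.+1] are arbitrary positive sizes. *)
Definition lower_left (M : 'M[R[i]]_((n + m.+1).+1)) : 'M[R[i]]_(m.+1, n.+1) :=
  @dlsubmx R[i] n.+1 m.+1 n.+1 m.+1 M.

Definition sylvester_block (A : 'M[R[i]]_n.+1) (B : 'M[R[i]]_m.+1)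
    (C : 'M[R[i]]_(m.+1, n.+1)) : 'M[R[i]]_((n + m.+1).+1) :=
  block_mx A 0 C B.

Definition eval_poly_mx k (p : {poly R}) (M : 'M[R[i]]_k.+1) : 'M[R[i]]_k.+1 :=
  horner_mx M (map_poly (real_complex R) p).

End Blocks.

(* Main.v *)
Require Import Defs.
From mathcomp Require Import measurable_realfun polyrcf lra ring zify.

(** Let [X] solve the Sylvester equation and [H] be the block matrix.  The lower
    left block of [q(H)] is [X q(A) - q(B) X] for every polynomial [q]
    ([lower_left_horner]), so the [N]-th partial sum of the series is
    [X S_N(A) - S_N(B) X], where [S_N] is the [N]-th partial sum of the
    expansion of the sign function in the orthonormal polynomials.  In
    eigenbases of [A] and [B] this multiplies each entry of [X] by
    [S_N(d_j) - S_N(e_i)] ([lower_left_horner_decomposition]), where the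
    eigenvalues [d_j] of [A] and [e_i] of [B] are interior points of the
    support.  It remains to see that [S_N] converges to the sign at every
    interior point [x]: the factors then tend to [1 - (-1) = 2].

    Let [K] be the Christoffel-Darboux kernel at [x], which reproduces
    polynomials of degree less than [N].  For each such [q],
      [S_N(x) - q(x) = int (sign - q) K w],
    and [|K| <= 1 + K ^ 2] bounds this by [(1 + K(x)) sup |sign - q|]
    ([fourier_partial_sum_error]).  Two estimates conclude.
    - The line meets the real axis inside a gap of the support, so on the
      support the sign is a step function with no values near its jump.  It is
      approximated at a geometric rate by the normalized antiderivative of
      [(1 - t ^ 2) ^ k], which is flat away from [0] ([sign_approximation]).
    - [K(x)] is [O(N ^ 3)] ([christoffel_darboux_diag_le]), because the weight
      is bounded below on some interval starting at [x].  This is a Markov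
      inequality at the end of an interval ([endpoint_derivative_bound]),
      applied to an antiderivative of [K ^ 2]; it follows from the vanishing of
      finite differences of order larger than the degree. *)

Set Implicit Arguments.
Unset Strict Implicit.
Unset Printing Implicit Defensive.

Import Order.TTheory GRing.Theory Num.Theory.
Import numFieldNormedType.Exports.

Local Open Scope classical_set_scope.
Local Open Scope ring_scope.
Local Open Scope complex_scope.

(** * A Markov inequality at an endpoint *)

Lemma size_sub_shift (F : fieldType) (q : {poly F}) n :
  (size q <= n.+1)%N -> (size (q - (q \Po ('X + 1)))%R <= n)%N.
Proof.
move=> sq; apply/leq_sizeP => j nj.
have s1 : size ('X + 1 : {poly F}) = 2 by rewrite -polyC1 size_XaddC.
have sc : size (q \Po ('X + 1)) = size q by rewrite size_comp_poly2.
case: (ltngtP n j) nj => // [nj|<-] _.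
  by rewrite coefB !nth_default ?subr0 // ?sc; apply: leq_trans nj.
case: (ltngtP (size q) n.+1) sq => // [sq|sq] _.
  by rewrite coefB !nth_default ?subr0 // ?sc; lia.
have lq : lead_coef (q \Po ('X + 1)) = lead_coef q.
  by rewrite lead_coef_comp ?s1 // -polyC1 lead_coefXaddC expr1n mulr1.
move: lq; rewrite /lead_coef sc sq /= coefB => ->; exact: subrr.
Qed.

(** The sum is the [n]-th finite difference of [q] up to sign, and each difference
    lowers the degree. *)
Lemma alternating_binomial_sum (F : fieldType) n (q : {poly F}) :
  (size q <= n)%N ->
  \sum_(k < n.+1) (-1) ^+ k * 'C(n, k)%:R * q.[k%:R] = 0.
Proof.
elim: n q => [q|n IHn q sq].
  by rewrite leqn0 size_poly_eq0 => /eqP ->; rewrite big_ord1 horner0 mulr0.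
rewrite -[RHS](IHn _ (size_sub_shift sq)).
rewrite big_ord_recl /= bin0 mulr1 expr0 mul1r.
under eq_bigr => i _ do rewrite /bump /= binS natrD mulrDr mulrDl.
rewrite big_split /= addrA big_ord_recr /= (bin_small (ltnSn n)).
rewrite mulr0 mul0r addr0.
under [RHS]eq_bigr => i _ do
  rewrite hornerD hornerN horner_comp hornerD hornerX hornerE mulrBr.
rewrite big_split /=; congr (_ + _).
  rewrite [RHS]big_ord_recl bin0 mulr1 expr0 mul1r; congr (_ + _).
apply: eq_bigr => i _.
by rewrite add1n exprS -natr1 !mulN1r !mulNr.
Qed.

Lemma bin_central_max n k : ('C(n.*2, k) <= 'C(n.*2, n))%N.
Proof.
have step j : (j < n)%N -> ('C(n.*2, j) <= 'C(n.*2, j.+1))%N.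
  move=> jn; have := mul_bin_left n.*2 j => e.
  by rewrite -(leq_pmul2l (ltn0Sn j)) e; apply: leq_mul => //; lia.
have low i : (i <= n -> 'C(n.*2, n - i) <= 'C(n.*2, n))%N.
  elim: i => [|i IH] ile; first by rewrite subn0.
  apply: leq_trans (IH (ltnW ile)).
  by rewrite -[(n - i)%N]prednK ?subn_gt0 -?subnS //; apply: step; lia.
case: (leqP k n) => kn; first by rewrite -(subKn kn); apply: low; lia.
case: (leqP k n.*2) => k2; last by rewrite bin_small.
rewrite -bin_sub //; have -> : (n.*2 - k = n - (k - n))%N by lia.
by apply: low; lia.
Qed.

(** The even polynomial [G(y ^ 2)], sampled at the [2n + 1] equidistant nodes
    [y = (k - n) / n], has a vanishing difference of order [2n].  The value at
    [y = 0] enters with the largest binomial coefficient, so it is at most the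
    sum of the other [2n] sampled values.  The squares cluster the nodes at the
    endpoint [0], which keeps the bound polynomial in [n]. *)
Lemma endpoint_value_bound (R : realType) n (G : {poly R}) (M : R) :
  (size G <= n)%N ->
  (forall i : nat, (0 < i <= n)%N -> `|G.[(i%:R / n%:R) ^+ 2]| <= M) ->
  `|G.[0]| <= (n.*2)%:R * M.
Proof.
move=> sG GM.
case: n sG GM => [|n'] sG GM.
  by move: sG; rewrite leqn0 size_poly_eq0 => /eqP ->; rewrite horner0 normr0 mul0r.
set n := n'.+1 in sG GM *.
have n0 : n%:R != 0 :> R by rewrite pnatr_eq0.
pose l : {poly R} := n%:R^-1 *: 'X - 1.
have le : forall x, l.[x] = (x - n%:R) / n%:R.
  by move=> x; rewrite /l !hornerE mulrBl divff // mulrC.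
have sl : (size l <= 2)%N.
  rewrite /l; apply: leq_trans (size_polyD _ _) _.
  rewrite geq_max size_polyN size_poly1 andbT.
  by rewrite (leq_trans (size_scale_leq _ _)) ?size_polyX.
have sl2 : (size (l ^+ 2) <= 3)%N.
  by apply: leq_trans (size_polyMleq _ _) _; lia.
pose q := G \Po (l ^+ 2).
have sq : (size q <= n.*2)%N.
  apply: leq_trans (size_comp_poly_leq _ _) _.
  have : ((size G).-1 * (size (l ^+ 2)%R).-1 <= n.-1 * 2)%N by apply: leq_mul; lia.
  rewrite /n; lia.
have := alternating_binomial_sum sq.
have nlt : (n < n.*2.+1)%N by lia.
rewrite (bigD1 (Ordinal nlt)) //= /q horner_comp horner_exp le subrr mul0r expr0n /=.
move/eqP; rewrite addr_eq0 => /eqP e.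
have b0 : 0 < 'C(n.*2, n)%:R :> R by rewrite ltr0n bin_gt0; lia.
rewrite -(ler_pM2l b0) -[X in X * _ <= _]gtr0_norm // -normrM.
have -> : `|('C(n.*2, n))%:R * G.[0]| = `|(-1) ^+ n * ('C(n.*2, n))%:R * G.[0]|.
  by rewrite -mulrA [in RHS]normrM normrX normrN1 expr1n mul1r.
rewrite e normrN; apply: le_trans (ler_norm_sum _ _ _) _.
apply: (@le_trans _ _ (\sum_(i < n.*2.+1 | i != Ordinal nlt) 'C(n.*2, n)%:R * M)).
  apply: ler_sum => i ni; rewrite !normrM normrX normrN1 expr1n mul1r.
  have ini : (i : nat) != n by apply: contra ni => /eqP h; apply/eqP/val_inj.
  apply: ler_pM => //; first by rewrite normr_nat ler_nat bin_central_max.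
  rewrite horner_comp horner_exp le.
  case: (leqP i n) => h.
    have := GM (n - i)%N; rewrite natrB // => H.
    by rewrite -sqrrN -mulNr opprB; apply: H; lia.
  have := GM (i - n)%N; rewrite natrB ?(ltnW h) // => H; apply: H.
  have := ltn_ord i; lia.
rewrite sumr_const -[X in X <= _]mulr_natl.
have -> : #|[pred i | i != Ordinal nlt]| = n.*2.
  by rewrite (cardC1 (Ordinal nlt)) card_ord.
by rewrite mulrCA.
Qed.

(** Divide the increment of [F] by the variable: the quotient takes the value
    [F'(0)] at [0], and division by a node [(i / n) ^ 2 >= 1 / n ^ 2] costs a
    factor [n ^ 2]. *)
Lemma endpoint_derivative_bound (R : realType) n (F : {poly R}) (M : R) :
  (size F <= n.+1)%N ->
  (forall y, 0 <= y <= 1 -> `|F.[y] - F.[0]| <= M) ->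
  `|F^`().[0]| <= (n ^ 3).*2%:R * M.
Proof.
move=> sF FM.
have : root (F - F.[0]%:P) 0 by rewrite /root !hornerE subrr.
case/factor_theorem => G; rewrite subr0 => e.
have -> : F^`().[0] = G.[0].
  have := congr1 (fun p => p^`().[0]) e.
  by rewrite /= derivB derivC subr0 derivM derivX mulr1 !hornerE.
have sG : (size G <= n)%N.
  have [->|G0] := eqVneq G 0; first by rewrite size_poly0.
  have : (size (G * 'X)%R <= n.+1)%N.
    rewrite -e; apply: leq_trans (size_polyD _ _) _.
    rewrite geq_max sF size_polyN size_polyC; by case: eqP.
  by rewrite size_mulX.
have M0 : 0 <= M by apply: le_trans (FM 0 _); rewrite ?normr_ge0 ?lexx ?ler01.
apply: le_trans (endpoint_value_bound (M := (n ^ 2)%:R * M) sG _) _; last first.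
  rewrite mulrA -natrM; apply: ler_wpM2r => //.
  by rewrite ler_nat -!mul2n -mulnA -expnS.
move=> i /andP[i0 iN]; set y := (_ / _) ^+ 2.
have n0 : 0 < n%:R :> R by rewrite ltr0n; lia.
have i0R : 1 <= i%:R :> R by rewrite ler1n.
have yn : 1 <= n%:R ^+ 2 * y.
  by rewrite /y expr_div_n mulrC divfK ?expf_neq0 ?gt_eqF // exprn_ege1.
have y0 : 0 < y by rewrite exprn_gt0 // divr_gt0 // ltr0n.
have y1 : y <= 1.
  by rewrite exprn_ile1 ?divr_ge0 ?ler0n // ler_pdivrMr // mul1r ler_nat.
have /FM : 0 <= y <= 1 by rewrite y1 ltW.
have := congr1 (fun p => p.[y]) e.
rewrite /= hornerD hornerN hornerC hornerM hornerX => -> H.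
rewrite -[leLHS]mul1r; apply: (@le_trans _ _ (n%:R ^+ 2 * y * `|G.[y]|)).
  exact: ler_wpM2r.
rewrite natrX -mulrA; apply: ler_wpM2l; first exact: exprn_ge0 (ltW n0).
by rewrite -[X in X * _](gtr0_norm y0) mulrC -normrM.
Qed.

(** * Antiderivatives of polynomials, and polynomial approximation of the sign *)

Definition antideriv (F : fieldType) (p : {poly F}) : {poly F} :=
  \poly_(i < (size p).+1) (p`_i.-1 / i%:R).

Lemma size_antideriv (F : fieldType) (p : {poly F}) :
  (size (antideriv p) <= (size p).+1)%N.
Proof. exact: size_poly. Qed.

Lemma antideriv0 (F : fieldType) (p : {poly F}) : (antideriv p).[0] = 0.
Proof. by rewrite horner_coef0 coef_poly /= invr0 mulr0. Qed.

Lemma antiderivK (F : numFieldType) (p : {poly F}) : (antideriv p)^`() = p.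
Proof.
apply/polyP => i; rewrite coef_deriv coef_poly /= ltnS.
case: ltnP => [_|ps]; last by rewrite mul0rn nth_default.
by rewrite -[LHS]mulr_natr divfK // pnatr_eq0.
Qed.

Lemma poly_nondecreasing (R : rcfType) (p : {poly R}) (a b : R) :
  a <= b -> (forall c, a < c < b -> 0 <= p^`().[c]) -> p.[a] <= p.[b].
Proof.
rewrite le_eqVlt => /predU1P[->//|ab] dp.
have [c cab e] := poly_mvt p ab.
by rewrite -subr_ge0 e mulr_ge0 ?subr_ge0 ?(ltW ab) // dp.
Qed.

Lemma Rintegral_poly (R : realType) (p : {poly R}) (a b : R) : a < b ->
  \int[lebesgue_measure]_(x in `[a, b]) p.[x] =
  (antideriv p).[b] - (antideriv p).[a].
Proof.
move=> ab; rewrite /Rintegral (continuous_FTC2 (F := horner (antideriv p)) ab) //.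
- by apply: continuous_subspaceT => x; exact: continuous_horner.
- split=> [x _||]; first exact: derivable_horner.
  + exact/cvg_at_right_filter/continuous_horner.
  + exact/cvg_at_left_filter/continuous_horner.
- by move=> x _; rewrite -derivE antiderivK.
Qed.

(** With [F] an antiderivative of [K ^ 2], this compares [F'(x)] with the
    increment of [F] over [[x, x + d]]; since [F] is nondecreasing, that
    increment bounds the oscillation of [F] there. *)
Lemma point_value_le_integral (R : realType) N (K : {poly R}) (x d : R) :
  0 < d -> (size K <= N)%N ->
  d * K.[x] ^+ 2 <=
  (N.*2 ^ 3).*2%:R * \int[lebesgue_measure]_(t in `[x, x + d]) (K ^+ 2).[t].
Proof.
move=> d0 sK; have xd : x < x + d by rewrite ltrDl.
rewrite Rintegral_poly //; set F := antideriv _.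
have F' : F^`() = K ^+ 2 by rewrite antiderivK.
have incF (a b : R) : a <= b -> F.[a] <= F.[b].
  by move=> ab; apply: poly_nondecreasing => // c _; rewrite F' horner_exp sqr_ge0.
pose l : {poly R} := d *: 'X + x%:P.
have lE t : l.[t] = d * t + x by rewrite /l !hornerE.
have sl : (size l <= 2)%N.
  apply: leq_trans (size_polyD _ _) _; rewrite geq_max.
  rewrite (leq_trans (size_scale_leq _ _)) ?size_polyX //= size_polyC.
  by case: eqP.
have sF : (size F <= N.*2.+1)%N.
  apply: leq_trans (size_antideriv _) _; rewrite ltnS.
  rewrite expr2 -addnn; apply: leq_trans (size_polyMleq _ _) _.
  by rewrite (leq_trans (leq_pred _)) ?leq_add.
have sFl : (size (F \Po l) <= N.*2.+1)%N.
  apply: leq_trans (size_comp_poly_leq _ _) _.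
  have : ((size F).-1 * (size l).-1 <= N.*2 * 1)%N by apply: leq_mul; lia.
  by rewrite muln1.
have := endpoint_derivative_bound sFl (M := F.[x + d] - F.[x]).
have -> : (F \Po l)^`().[0] = d * K.[x] ^+ 2.
  rewrite deriv_comp hornerM horner_comp lE mulr0 add0r F' horner_exp.
  by rewrite /l derivD derivZ derivX derivC addr0 hornerZ hornerC mulr1 mulrC.
rewrite ger0_norm; last by rewrite mulr_ge0 ?sqr_ge0 ?(ltW d0).
apply => y /andP[y0 y1].
rewrite !horner_comp !lE mulr0 add0r.
have h1 : F.[x] <= F.[d * y + x] by apply: incF; rewrite lerDr mulr_ge0 // ltW.
have h2 : F.[d * y + x] <= F.[x + d].
  by apply: incF; rewrite addrC lerD2l ger_pMr.
by rewrite ger0_norm ?subr_ge0 // lerD2r.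
Qed.

(** An antiderivative [Q] of [(1 - t ^ 2) ^ n] makes nearly all of its increase
    over [[-1, 1]] in [[-d, d]].  Rescaling it affinely to take the values [-1]
    and [1] at [-1] and [1] gives the approximation. *)
Lemma sign_approximation (R : realType) (d : R) n : 0 < d -> d < 1 ->
  exists2 q : {poly R}, (size q <= n.+1.*2)%N &
  forall t, (d <= t <= 1 -> `|q.[t] - 1| <= n.+1.*2%:R * (1 - d ^+ 2) ^+ n) /\
            (-1 <= t <= - d -> `|q.[t] + 1| <= n.+1.*2%:R * (1 - d ^+ 2) ^+ n).
Proof.
move=> d0 d1.
pose b : {poly R} := 1 - 'X ^+ 2.
have bE (t : R) : b.[t] = 1 - t ^+ 2.
  by rewrite /b hornerD hornerN horner_exp hornerX hornerC.
pose Q := antideriv (b ^+ n).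
have Q' (t : R) : Q^`().[t] = (1 - t ^+ 2) ^+ n.
  by rewrite antiderivK horner_exp bE.
have sq1 (t : R) : -1 <= t <= 1 -> 0 <= 1 - t ^+ 2.
  by move=> /andP[h1 h2]; nra.
have incQ (s t : R) : -1 <= s -> s <= t -> t <= 1 -> Q.[s] <= Q.[t].
  move=> s1 st t1; apply: poly_nondecreasing => // c /andP[sc ct].
  rewrite Q' exprn_ge0 // sq1 //; apply/andP; split; lra.
have flat (s t : R) : s <= t -> (-1 <= s /\ t <= - d) \/ (d <= s /\ t <= 1) ->
    Q.[t] - Q.[s] <= (1 - d ^+ 2) ^+ n.
  rewrite le_eqVlt => /predU1P[-> _|st sd].
    by rewrite subrr exprn_ge0 // sq1 //; apply/andP; split; lra.
  have [c cst ->] := poly_mvt Q st.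
  have /andP[sc ct] : s < c < t by move: cst; rewrite in_itv.
  have dc : 1 - c ^+ 2 <= 1 - d ^+ 2 by nra.
  have c0 : 0 <= 1 - c ^+ 2 by apply: sq1; apply/andP; split; lra.
  rewrite Q' -[leRHS]mulr1; apply: ler_pM.
  - exact: exprn_ge0.
  - by rewrite subr_ge0 ltW.
  - by rewrite lerXn2r // nnegrE (le_trans c0).
  - lra.
have n1 : 0 < n.+1%:R :> R by rewrite ltr0n.
(* Adding [(1 - t) ^ n.+1 / n.+1] subtracts [(1 - t) ^ n] from the derivative,
   which stays nonnegative on [0, 1]. *)
have big : n.+1%:R^-1 <= Q.[1] - Q.[-1].
  pose P : {poly R} := Q + n.+1%:R^-1 *: (1 - 'X) ^+ n.+1.
  have PE t : P.[t] = Q.[t] + n.+1%:R^-1 * (1 - t) ^+ n.+1.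
    by rewrite /P !(hornerD, hornerZ, horner_exp, hornerN, hornerX, hornerC).
  have : P.[0] <= P.[1].
    apply: poly_nondecreasing => // c /andP[c0 c1].
    rewrite /P derivD derivZ deriv_exp derivB derivX -polyC1 derivC sub0r /=.
    rewrite hornerD Q' hornerZ hornerMn hornerM hornerN hornerC mulN1r horner_exp.
    rewrite hornerD hornerN hornerX hornerC -[X in _^-1 * X]mulr_natl mulrA.
    rewrite mulVf ?gt_eqF // mul1r subr_ge0 lerXn2r ?nnegrE //; nra.
  rewrite !PE subrr expr0n /= mulr0 addr0 subr0 expr1n mulr1 antideriv0 add0r.
  move=> h; apply: le_trans h _; rewrite lerDl oppr_ge0 -(antideriv0 (b ^+ n)).
  by apply: incQ; rewrite // lerN10.
have D0 : 0 < Q.[1] - Q.[-1] by apply: lt_le_trans big; rewrite invr_gt0.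
have sQ : (size Q <= n.+1.*2)%N.
  apply: leq_trans (size_antideriv _) _.
  have sb : (size b <= 3)%N.
    apply: leq_trans (size_polyD _ _) _.
    by rewrite geq_max size_polyN size_polyXn size_poly1.
  rewrite doubleS !ltnS; apply: leq_trans (size_poly_exp_leq _ _) _.
  by rewrite ltnS -mul2n leq_mul //; move: sb; case: (size _).
exists (2 / (Q.[1] - Q.[-1]) *: (Q - Q.[-1]%:P) - 1).
  apply: leq_trans (size_polyD _ _) _.
  rewrite geq_max size_polyN size_poly1 andbT.
  apply: leq_trans (size_scale_leq _ _) _.
  apply: leq_trans (size_polyD _ _) _.
  by rewrite geq_max sQ size_polyN size_polyC; case: eqP.
have scale (y : R) : 0 <= y -> y <= (1 - d ^+ 2) ^+ n ->
    2 / (Q.[1] - Q.[-1]) * y <= n.+1.*2%:R * (1 - d ^+ 2) ^+ n.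
  move=> y0 yb; rewrite -muln2 natrM; apply: ler_pM => //.
    by rewrite divr_ge0 // ltW.
  by rewrite mulrC ler_wpM2r // -[leRHS]invrK lef_pV2 ?posrE ?invr_gt0.
move=> t; rewrite hornerD hornerN hornerZ hornerD hornerN !hornerC.
split=> /andP[t1 t2].
  have -> : 2 / (Q.[1] - Q.[-1]) * (Q.[t] - Q.[-1]) - 1 - 1 =
            - (2 / (Q.[1] - Q.[-1]) * (Q.[1] - Q.[t])).
    by field; rewrite gt_eqF.
  have h : 0 <= Q.[1] - Q.[t] by rewrite subr_ge0 incQ //; lra.
  rewrite normrN ger0_norm; last by rewrite mulr_ge0 // divr_ge0 // ltW.
  by apply: scale => //; apply: flat => //; right.
have h : 0 <= Q.[t] - Q.[-1] by rewrite subr_ge0 incQ //; lra.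
rewrite subrK ger0_norm; last by rewrite mulr_ge0 // divr_ge0 // ltW.
by apply: scale => //; apply: flat => //; left.
Qed.

(** * Expansions in orthonormal polynomials *)

(** Each of the [n] terms of the geometric sum [1 + s + ... + s ^ (n - 1)] is at
    least [s ^ n]. *)
Lemma natmul_expr_le (R : realFieldType) (s : R) n :
  0 <= s -> s <= 1 -> n%:R * s ^+ n * (1 - s) <= 1 - s ^+ n.
Proof.
move=> s0 s1; elim: n => [|n IHn]; first by rewrite !mul0r expr0 subrr.
have h : 0 <= (1 - s) * (1 - s ^+ n.+1).
  by rewrite mulr_ge0 ?subr_ge0 ?exprn_ile1.
have := ler_wpM2l s0 IHn; move: h; rewrite -natr1 exprS.
set u := s ^+ n; set v := n%:R; nra.
Qed.

(** Induction on the exponent: with [s] the square root of [r], one factor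
    [n * s ^ n] is bounded and the other, [n ^ k * s ^ n], tends to [0]. *)
Lemma cvg_monomial_geometric (R : realType) k (r : R) : 0 <= r -> r < 1 ->
  n%:R ^+ k * r ^+ n @[n --> \oo] --> 0.
Proof.
elim: k r => [|k IHk] r r0 r1.
  under eq_fun do rewrite expr0 mul1r.
  by apply: cvg_expr; rewrite ger0_norm.
pose s := Num.sqrt r.
have s0 : 0 <= s by exact: sqrtr_ge0.
have s1 : s < 1 by rewrite -sqrtr1 ltr_sqrt.
have rE : r = s ^+ 2 by rewrite sqr_sqrtr.
have c0 : 0 < 1 - s by rewrite subr_gt0.
apply: (@squeeze_cvgr _ _ _ _ (fun=> 0)
    (fun n => (1 - s)^-1 * (n%:R ^+ k * s ^+ n))).
- apply: nearW => n; rewrite !mulr_ge0 ?exprn_ge0 ?ler0n //= rE.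
  have -> : n%:R ^+ k.+1 * (s ^+ 2) ^+ n = (n%:R * s ^+ n) * (n%:R ^+ k * s ^+ n).
    by rewrite exprS -exprM mul2n -addnn exprD; ring.
  apply: ler_wpM2r; first by rewrite mulr_ge0 ?exprn_ge0 ?ler0n.
  rewrite -[leRHS]mul1r ler_pdivlMr //.
  apply: le_trans (natmul_expr_le n s0 (ltW s1)) _.
  by rewrite gerBl exprn_ge0.
- exact: cvg_cst.
- by rewrite -[X in _ --> X](mulr0 (1 - s)^-1); apply: cvgMr; exact: IHk.
Qed.

Lemma integrableZl_fine (R : realType) (D : set R) (a : R) (f : R -> R) :
  measurable D -> lebesgue_measure.-integrable D (EFin \o f) ->
  lebesgue_measure.-integrable D (EFin \o (fun t => a * f t)).
Proof.
by move=> mD fi; have := integrableZl _ a fi; apply.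
Qed.

Section Expansion.
Context {R : realType} (S : set R) (w : R -> R) (p : nat -> {poly R}).
Local Notation mu := (@lebesgue_measure R).

Context (mS : measurable S) (L : R) (S_bounded : forall x, S x -> `|x| <= L).
Context (w_ge0 : forall x, 0 <= w x) (w_int : mu.-integrable S (EFin \o w)).
Context (w_mass : \int[mu]_(x in S) w x = 1).
Context (p_orth : orthonormal_polynomials S w p).

Lemma integrable_weighted (f : R -> R) (M : R) (q : {poly R}) :
  measurable_fun S f -> (forall x, S x -> `|f x| <= M) ->
  mu.-integrable S (EFin \o (fun x => f x * q.[x] * w x)).
Proof.
move=> mf fM.
have mq : measurable_fun S (horner q).
  exact: measurable_poly.
have [B qB] : exists B, forall x, S x -> `|q.[x]| <= B.
  have : compact (horner q @` `[- L, L]).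
    apply: continuous_compact (@segment_compact _ _ _).
    apply: continuous_subspaceT => x; exact: continuous_horner.
  move=> /compact_bounded[B [_ HB]]; exists (B + 1) => x Sx.
  apply: (HB (B + 1)); first by rewrite ltrDl.
  exists x => //=.
  by rewrite in_itv /= -ler_norml S_bounded.
have -> : EFin \o (fun x => f x * q.[x] * w x) =
    ((EFin \o w) \* (EFin \o (fun x => (f x * q.[x])%R)))%E.
  by apply/funext => x /=; rewrite -EFinM mulrC.
apply: integrableMl => //; first exact: measurable_funM.
exists (`|M| * `|B|); split; first exact: num_real.
move=> y My x Sx /=; apply: le_trans (ltW My); rewrite normrM.
by apply: ler_pM => //; rewrite (le_trans _ (ler_norm _)) ?fM ?qB.
Qed.

Lemma integrable_weighted_poly (q : {poly R}) :
  mu.-integrable S (EFin \o (fun x => q.[x] * w x)).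
Proof.
have := @integrable_weighted (cst 1) 1 q (@measurable_cst _ _ _ _ _ _).
under eq_fun => x do rewrite /= mul1r.
by apply=> x _ /=; rewrite normr1.
Qed.

Definition moment (q : {poly R}) : R := \int[mu]_(x in S) (q.[x] * w x).

Lemma moment0 : moment 0 = 0.
Proof.
rewrite /moment; under eq_Rintegral => x _ do rewrite horner0 mul0r -(mul0r 0).
by rewrite RintegralZl ?mul0r //; exact: integrable0.
Qed.

Lemma momentDZ (a : R) (q r : {poly R}) :
  moment (q + a *: r) = moment q + a * moment r.
Proof.
rewrite /moment; under eq_Rintegral => x _ do
  rewrite hornerD hornerZ mulrDl -mulrA.
rewrite RintegralD ?RintegralZl //; try exact: integrable_weighted_poly.
exact: integrableZl_fine (integrable_weighted_poly r).
Qed.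

Lemma moment_sum N (a : nat -> R) (q : nat -> {poly R}) :
  moment (\sum_(j < N) a j *: q j) = \sum_(j < N) a j * moment (q j).
Proof.
elim: N => [|N IHN]; first by rewrite !big_ord0 moment0.
by rewrite !big_ord_recr /= momentDZ IHN.
Qed.

Lemma moment_orth j k : moment (p j * p k) = (j == k)%:R.
Proof.
rewrite -(orthonormal_integral p_orth).
by apply: eq_Rintegral => x _; rewrite hornerM.
Qed.

Lemma orthonormal_basis N (q : {poly R}) : (size q <= N)%N ->
  exists c : nat -> R, q = \sum_(j < N) c j *: p j.
Proof.
elim: N q => [|N IHN] q sq.
  by exists (fun=> 0); rewrite big_ord0; apply/eqP; rewrite -size_poly_leq0.
have lp := orthonormal_lead_gt0 p_orth N.
have sp := orthonormal_size p_orth N.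
pose a := q`_N / lead_coef (p N).
have [|c qE] := IHN (q - a *: p N).
  apply/leq_sizeP => j Nj; rewrite coefB coefZ.
  move: Nj; rewrite leq_eqVlt => /predU1P[<-|Nj].
    rewrite [(p N)`_N](_ : _ = lead_coef (p N)); last by rewrite lead_coefE sp.
    by rewrite divfK ?subrr ?gt_eqF.
  by rewrite !nth_default ?mulr0 ?subr0 ?sp // (leq_trans sq).
exists (fun j => if (j == N)%N then a else c j).
rewrite big_ord_recr /= eqxx -[LHS](subrK (a *: p N)) qE; congr (_ + _).
by apply: eq_bigr => j _; rewrite ltn_eqF.
Qed.

Definition christoffel_darboux N (x : R) : {poly R} :=
  \sum_(j < N) (p j).[x] *: p j.
Local Notation K := christoffel_darboux.

Lemma size_christoffel_darboux N x : (size (K N x) <= N)%N.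
Proof.
apply: leq_trans (size_sum _ _ _) _; apply/bigmax_leqP => j _.
by rewrite (leq_trans (size_scale_leq _ _)) // (orthonormal_size p_orth) ltn_ord.
Qed.

(** The kernel at [x] is orthogonal projection followed by evaluation at [x]. *)
Lemma moment_reproducing N x (q : {poly R}) : (size q <= N)%N ->
  moment (q * K N x) = q.[x].
Proof.
move=> /orthonormal_basis[c ->].
rewrite mulr_suml horner_sum.
under eq_bigr => j _ do rewrite -scalerAl.
rewrite (@moment_sum _ _ (fun j => p j * K N x)); apply: eq_bigr => j _.
rewrite hornerZ; congr (_ * _).
rewrite mulr_sumr; under eq_bigr => i _ do rewrite -scalerAr.
rewrite (@moment_sum _ (fun i => (p i).[x]) (fun i => p j * p i)).
rewrite (bigD1 j) //= moment_orth eqxx mulr1 big1 ?addr0 // => i ij.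
rewrite moment_orth (_ : (j == i :> nat) = false) ?mulr0 //.
by apply/negbTE; rewrite eq_sym.
Qed.

Lemma christoffel_darboux_diag_ge0 N x : 0 <= (K N x).[x].
Proof.
rewrite horner_sum sumr_ge0 // => j _.
by rewrite hornerZ -expr2 sqr_ge0.
Qed.

(** Write [K] for the kernel at [x].  By reproduction [K(x)] is the weighted
    integral of [K ^ 2], hence at least [c] times the plain integral of [K ^ 2]
    over [[x, x + d]], which controls [K(x) ^ 2].  One factor [K(x)] cancels. *)
Lemma christoffel_darboux_diag_le N x (c d : R) : 0 < c -> 0 < d ->
  (forall t, x <= t <= x + d -> S t /\ c <= w t) ->
  c * d * (K N x).[x] <= (N.*2 ^ 3).*2%:R.
Proof.
move=> c0 d0 cw; set Kx := K N x; set C := _%:R.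
have k0 : 0 <= Kx.[x] := christoffel_darboux_diag_ge0 N x.
have sI : `[x, x + d]%classic `<=` S.
  by move=> t /=; rewrite in_itv => /cw[].
have iK := integrable_weighted_poly (Kx ^+ 2).
have iKI : mu.-integrable `[x, x + d] (EFin \o (fun t => (Kx ^+ 2).[t] * w t)).
  exact: integrableS iK.
have h1 := point_value_le_integral x d0 (size_christoffel_darboux N x).
have h2 : c * \int[mu]_(t in `[x, x + d]) (Kx ^+ 2).[t] <=
    \int[mu]_(t in `[x, x + d]) ((Kx ^+ 2).[t] * w t).
  have ip : mu.-integrable `[x, x + d] (EFin \o horner (Kx ^+ 2)).
    apply: continuous_compact_integrable; first exact: segment_compact.
    by apply: continuous_subspaceT => t; exact: continuous_horner.
  rewrite -RintegralZl //; apply: le_Rintegral => //.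
    exact: integrableZl_fine ip.
  move=> t /=; rewrite in_itv /= => /cw[_ h].
  by rewrite mulrC ler_wpM2l // horner_exp sqr_ge0.
have h3 : \int[mu]_(t in `[x, x + d]) ((Kx ^+ 2).[t] * w t) <= Kx.[x].
  rewrite -[leRHS](moment_reproducing x (size_christoffel_darboux N x)) -expr2.
  apply: fine_le; rewrite ?integrable_fin_num //.
  apply: ge0_subset_integral => //; first exact: (measurable_int _ iK).
  by move=> t _ /=; rewrite lee_fin mulr_ge0 // horner_exp sqr_ge0.
move: k0; rewrite le_eqVlt => /predU1P[<-|k0]; first by rewrite mulr0 ler0n.
rewrite -(ler_pM2r k0).
rewrite (_ : c * d * Kx.[x] * Kx.[x] = c * (d * Kx.[x] ^+ 2)); last by ring.
apply: le_trans (ler_wpM2l (ltW c0) h1) _.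
rewrite -/C mulrCA; apply: ler_wpM2l; first exact: ler0n.
exact: le_trans h2 h3.
Qed.

(** By reproduction both terms are integrals against the kernel at [x], so their
    difference is the integral of [(f - q) K w].  Replacing [|K|] by
    [1 + K ^ 2], whose weighted integral is known exactly, takes the place of
    the Cauchy-Schwarz inequality. *)
Lemma fourier_partial_sum_error (f : R -> R) (M : R) (N : nat) (x e : R)
    (q : {poly R}) :
  measurable_fun S f -> (forall t, S t -> `|f t| <= M) -> 0 <= e ->
  (size q <= N)%N -> (forall t, S t -> `|f t - q.[t]| <= e) ->
  `|\sum_(j < N) \int[mu]_(t in S) (f t * (p j).[t] * w t) * (p j).[x] - q.[x]|
    <= e * (1 + (K N x).[x]).
Proof.
move=> mf fM e0 sq fq.
have intf r : mu.-integrable S (EFin \o (fun t => f t * r.[t] * w t)).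
  exact: integrable_weighted mf fM.
have -> : \sum_(j < N) \int[mu]_(t in S) (f t * (p j).[t] * w t) * (p j).[x] =
    \int[mu]_(t in S) (f t * (K N x).[t] * w t).
  rewrite /K; elim: N {sq} => [|N IHN].
    rewrite big_ord0; under eq_Rintegral => t _ do
      rewrite big_ord0 horner0 mulr0 mul0r -(mul0r 0).
    by rewrite RintegralZl ?mul0r //; exact: integrable0.
  rewrite big_ord_recr /= IHN mulrC -RintegralZl // -RintegralD //.
    by apply: eq_Rintegral => t _; rewrite big_ord_recr hornerD hornerZ /=; ring.
  exact: integrableZl_fine (intf (p N)).
have intq := integrable_weighted_poly (q * K N x).
rewrite -(moment_reproducing x sq) /moment -RintegralB //.
have -> : \int[mu]_(t in S) (f t * (K N x).[t] * w t - (q * K N x).[t] * w t) =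
    \int[mu]_(t in S) ((f t - q.[t]) * (K N x).[t] * w t).
  by apply: eq_Rintegral => t _; rewrite hornerM; ring.
have intfq :
    mu.-integrable S (EFin \o (fun t => (f t - q.[t]) * (K N x).[t] * w t)).
  apply: integrable_weighted fq.
  by apply: measurable_funB => //; exact: measurable_poly.
apply: le_trans (le_normr_Rintegral _ intfq) _; first exact: mS.
pose Q := 1 + K N x * K N x.
have momQ : moment Q = 1 + (K N x).[x].
  rewrite /Q -[X in moment (1 + X)]scale1r momentDZ mul1r.
  rewrite moment_reproducing ?size_christoffel_darboux //; congr (_ + _).
  by rewrite -w_mass; apply: eq_Rintegral => t _; rewrite hornerC mul1r.
rewrite -momQ /moment -RintegralZl //; last exact: integrable_weighted_poly.
apply: le_Rintegral => //.
- exact: integrable_norm.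
- exact: integrableZl_fine (integrable_weighted_poly Q).
move=> t St; rewrite !normrM [`|w t|]ger0_norm // !mulrA.
apply: ler_wpM2r => //; apply: ler_pM => //; first exact: fq.
rewrite /Q hornerD hornerM hornerC; have := sqr_ge0 (1 - `|(K N x).[t]|).
have := normr_ge0 (K N x).[t]; have := real_normK (num_real (K N x).[t]).
set u := `|_|; set v := _.[t]; rewrite !expr2 => e1 h1 h2; nra.
Qed.
End Expansion.

(** * Pointwise convergence for a step function on a union of intervals *)

(** The sign approximation, transported by the affine map that sends the jump
    [x0] to [0] and the points at distance [D] from it to [-1] and [1]. *)
Lemma step_approximation (R : realType) (x0 s d D : R) k : 0 < d -> d < D ->
  exists2 q : {poly R}, (size q <= k.+1.*2)%N &
  forall t, d <= `|t - x0| <= D ->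
    `|(if x0 < t then s else - s) - q.[t]|
      <= `|s| * (k.+1.*2%:R * (1 - (d / D) ^+ 2) ^+ k).
Proof.
move=> d0 dD; have D0 : 0 < D := lt_trans d0 dD.
have [||q sq qE] := @sign_approximation _ (d / D) k; first exact: divr_gt0.
  by rewrite ltr_pdivrMr // mul1r.
pose l : {poly R} := D^-1 *: ('X - x0%:P).
have lE t : l.[t] = (t - x0) / D by rewrite /l hornerZ hornerXsubC mulrC.
have sl : (size l <= 2)%N.
  by rewrite (leq_trans (size_scale_leq _ _)) ?size_XsubC.
exists (s *: (q \Po l)).
  apply: leq_trans (size_scale_leq _ _) _.
  apply: leq_trans (size_comp_poly_leq _ _) _.
  have : ((size q).-1 * (size l).-1 <= (k.+1.*2).-1 * 1)%N.
    by apply: leq_mul; [move: sq|move: sl]; clear; lia.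
  by clear; lia.
move=> t; have [qp qm] := qE (l.[t]); rewrite hornerZ horner_comp.
case: (ltP x0 t) => h /andP[dt tD].
  rewrite -[X in X - _]mulr1 -mulrBr normrM ler_wpM2l // distrC; apply: qp.
  move: dt tD; rewrite gtr0_norm ?subr_gt0 // => dt tD.
  by rewrite lE ler_pM2r ?invr_gt0 // ler_pdivrMr // mul1r dt.
rewrite -mulrN1 -mulrBr normrM ler_wpM2l // -normrN opprB opprK; apply: qm.
move: dt tD; rewrite ler0_norm ?subr_le0 // => dt tD.
rewrite lE -mulNr ler_pM2r ?invr_gt0 // ler_pdivlMr // mulN1r.
by apply/andP; split; lra.
Qed.

Section IntervalsUnion.
Context {R : realType} {g : nat} (beta gamma : 'I_g.+1 -> R).
Local Notation S := (intervals_union beta gamma).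

Lemma measurable_intervals_union : measurable S.
Proof. by apply: fin_bigcup_measurable => [|j _]; [exact: finite_finset|]. Qed.

Lemma intervals_union_gap x : ~ S x ->
  exists2 d : R, 0 < d & forall t, S t -> d <= `|t - x|.
Proof.
move=> nSx.
have /closed_openC oS : closed S.
  by apply: closed_bigcup => [|j _]; [exact: finite_finset|exact: itv_closed].
have /nbhs_ballP[d /= d0 dS] : nbhs x (~` S) by exact: open_nbhs_nbhs.
exists d => // t St; rewrite leNgt; apply/negP => td.
by apply: (dS t) => //; rewrite /ball /= distrC.
Qed.

Lemma intervals_union_bounded : exists L : R, forall x, S x -> `|x| <= L.
Proof.
exists (\sum_j (`|beta j| + `|gamma j|)) => x [j _ /=].
rewrite in_itv /= => /andP[bx xg]; rewrite (bigD1 j) //=.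
apply: le_trans (_ : `|beta j| + `|gamma j| <= _).
  rewrite ler_norml; have := ler_norm (- beta j); have := ler_norm (gamma j).
  have := normr_ge0 (beta j); have := normr_ge0 (gamma j); rewrite normrN.
  by move=> ? ? ? ?; apply/andP; split; lra.
by rewrite lerDl sumr_ge0 // => i _; rewrite addr_ge0.
Qed.

Lemma intervals_union_boundary :
  S `\` S° `<=` (range beta `|` range gamma).
Proof.
move=> x [[j _ /=]]; rewrite in_itv /= => /andP[].
rewrite le_eqVlt => /predU1P[<- _ _|bx]; first by left; exists j.
rewrite le_eqVlt => /predU1P[-> _|xg nS]; first by right; exists j.
exfalso; apply: nS; apply: (@nbhs_singleton _ x); apply: nbhs_interior.
have : `]beta j, gamma j[%classic `<=` S.
  move=> t /=; rewrite in_itv /= => /andP[h1 h2]; exists j => //=.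
  by rewrite in_itv /= !ltW.
move/filterS; apply; apply: open_nbhs_nbhs; split; first exact: itv_open.
by rewrite /= in_itv /= bx.
Qed.

(** Measurability comes from continuity on the interior, the rest of the support
    being a finite set of endpoints.  Integrability is part of the
    normalization: a real-valued integral equal to [1] cannot come from an
    infinite one, as [fine +oo = 0]. *)
Lemma integrable_admissible_weight (w : R -> R) :
  admissible_weight beta gamma w ->
  (@lebesgue_measure R).-integrable S (EFin \o w).
Proof.
move=> wa.
have mSi : measurable S° by apply: open_measurable; exact: open_interior.
have mw : measurable_fun S w.
  have -> : S = S° `|` (S `\` S°) by rewrite setDUK //; exact: interior_subset.
  apply/measurable_funU => //; first exact: measurableD measurable_intervals_union _.
  split.
    apply: open_continuous_measurable_fun; first exact: open_interior.
    by move=> x; rewrite inE => /(weight_continuous wa).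
  move=> _ Y _; apply: countable_measurable; first by move=> t; exact: measurable_set1.
  apply: finite_set_countable.
  apply: (@sub_finite_set _ _ (range beta `|` range gamma)).
    by move=> x [/intervals_union_boundary].
  by rewrite finite_setU; split; apply: finite_image; exact: finite_finset.
apply/integrableP; split; first exact/measurable_EFinP.
under eq_integral => x _ do rewrite /= ger0_norm ?(weight_ge0 wa) //.
have := weight_normalized wa; rewrite /Rintegral.
have : (0 <= \int[lebesgue_measure]_(x in S) (w x)%:E)%E.
  by apply: integral_ge0 => x _; rewrite lee_fin (weight_ge0 wa).
case: (integral _ _ _) => //= [r _ _|_ /esym /eqP]; first exact: ltry.
by rewrite oner_eq0.
Qed.

Lemma admissible_weight_locally_bounded_below (w : R -> R) x :
  admissible_weight beta gamma w -> S° x ->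
  exists c d : R, [/\ 0 < c, 0 < d &
    forall t, x <= t <= x + d -> S t /\ c <= w t].
Proof.
move=> wa Sx; have w0 := weight_gt0 wa Sx.
have : \forall t \near x, S t /\ w x / 2 <= w t.
  near=> t; split; first by near: t.
  near: t; have /cvgr_ge := weight_continuous wa Sx; apply.
  by rewrite ltr_pdivrMr // ltr_pMr // ltr1n.
move/nbhs_ballP => [d /= d0 dS].
exists (w x / 2), (d / 2); split; rewrite ?divr_gt0 // => t /andP[t1 t2].
by apply: dS; rewrite /ball /= ltr_norml; apply/andP; split; lra.
Unshelve. all: by end_near.
Qed.

(** The approximating polynomial is taken of degree less than [2 * N./2]; with
    [k = N./2] the error is then at most a constant times
    [k * r ^ k * (1 + k ^ 3)]. *)
Lemma sign_expansion_cvg (w : R -> R) (p : nat -> {poly R}) (f : R -> R)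
    (x0 s x : R) :
  admissible_weight beta gamma w -> orthonormal_polynomials S w p ->
  ~ S x0 -> `|s| = 1 ->
  (forall t, S t -> f t = if x0 < t then s else - s) -> S° x ->
  \sum_(j < N) \int[lebesgue_measure]_(t in S) (f t * (p j).[t] * w t) * (p j).[x]
    @[N --> \oo] --> f x.
Proof.
move=> wa po nS s1 fE Sx.
have [d d0 dS] := intervals_union_gap nS.
have [L LS] := intervals_union_bounded.
have [c [e [c0 e0 ce]]] := admissible_weight_locally_bounded_below wa Sx.
have w_int := integrable_admissible_weight wa.
have mS := measurable_intervals_union.
have w_mass := weight_normalized wa.
have w_ge0 := weight_ge0 wa.
have SxS : S x := interior_subset Sx.
(* [S] lies at distance between [d] and [D] from the jump, and the summand [1]
   makes [d < D] strict. *)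
pose D := 1 + d + `|L| + `|x0|.
have dD : d < D.
  by have := normr_ge0 L; have := normr_ge0 x0; rewrite /D => ? ?; lra.
have D0 : 0 < D := lt_trans d0 dD.
have dtD t : S t -> d <= `|t - x0| <= D.
  move=> St; rewrite dS //=; apply: le_trans (ler_normB _ _) _.
  by have := LS t St; have := ler_norm L; rewrite /D => ? ?; lra.
pose r := 1 - (d / D) ^+ 2.
have r0 : 0 < r.
  by rewrite subr_gt0 exprn_ilt1 // ?divr_ge0 ?ltW // ltr_pdivrMr // mul1r.
have r1 : r < 1 by rewrite gtrBl exprn_gt0 // divr_gt0.
have mf : measurable_fun S f.
  have := measurable_fun_ifT (T1 := R) (T2 := R) (f := fun t => x0 < t)
    (g := cst s) (h := cst (- s)).
  move=> /(_ _ (measurable_cst _) (measurable_cst _)) H.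
  apply: (eq_measurable_fun (fun t => if x0 < t then s else - s)).
    by move=> t; rewrite inE => /fE.
  apply: measurable_funTS; apply: H; exact: measurable_fun_ltr.
have f1 t : S t -> `|f t| <= 1.
  by move=> /fE ->; case: ifP; rewrite ?normrN s1.
(* The diagonal of the kernel is at most [432 * k ^ 3 / (c * e)] with [k = N./2],
   since [N <= 3 * k] and [432 = 2 * 6 ^ 3]. *)
pose B := 2 / r * (2 + 432 / (c * e)).
have main N : (2 <= N)%N ->
  `|\sum_(j < N) \int[lebesgue_measure]_(t in S) (f t * (p j).[t] * w t)
      * (p j).[x] - f x|
   <= B * ((N./2)%:R ^+ 4 * r ^+ N./2).
  move=> N2.
  have [k kE] : exists k, N./2 = k.+1.
    by exists N./2.-1; move: N2; clear; lia.
  have k1N : (k.+1.*2 <= N)%N by move: kE; clear; lia.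
  have [q sq qE] := step_approximation x0 s k d0 dD.
  have sqN := leq_trans sq k1N.
  pose err := k.+1.*2%:R * r ^+ k.
  have err0 : 0 <= err by rewrite mulr_ge0 ?ler0n // exprn_ge0 // ltW.
  have fq t : S t -> `|f t - q.[t]| <= err.
    by move=> St; rewrite (fE t St) -[leRHS]mul1r -s1; apply/qE/dtD.
  have := fourier_partial_sum_error mS LS w_ge0 w_int w_mass po x mf f1 err0 sqN fq.
  have := christoffel_darboux_diag_le mS LS w_ge0 w_int po N c0 e0 ce.
  set K := _.[x]; set SN := \sum_(j < N) _ => hK hS.
  have hx := fq x SxS.
  have : `|SN - f x| <= err * (2 + K).
    rewrite -(subrKA q.[x]); apply: le_trans (ler_normD _ _) _.
    by rewrite distrC in hx; move: hS hx; clear; lra.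
  move=> h; apply: le_trans h _.
  have ce0 : 0 < c * e by rewrite mulr_gt0.
  have k1 : 1 <= k.+1%:R :> R by rewrite ler1n.
  have KB : K <= 432 / (c * e) * k.+1%:R ^+ 3.
    rewrite -mulrA [_^-1 * _]mulrC mulrA ler_pdivlMr // mulrC.
    apply: le_trans hK _; rewrite -natrX -natrM ler_nat.
    have : (N.*2 ^ 3 <= (6 * k.+1) ^ 3)%N.
      by rewrite leq_exp2r //; move: kE; clear; lia.
    rewrite expnMn -[(6 ^ 3)%N]/216%N -[432%N]/(216.*2)%N -doubleMl => h.
    by rewrite leq_double.
  rewrite kE /err.
  have -> : B * (k.+1%:R ^+ 4 * r ^+ k.+1) =
     k.+1.*2%:R * r ^+ k * (k.+1%:R ^+ 3 * (2 + 432 / (c * e))).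
    rewrite -muln2 natrM /B !exprS; field; rewrite !gt_eqF //.
  apply: ler_wpM2l => //.
  have k3 : 1 <= k.+1%:R ^+ 3 :> R by rewrite exprn_ege1.
  rewrite mulrDr [_ ^+ 3 * (432 / _)]mulrC.
  by move: KB k3; set u := _ / _ * _; clear; lra.
have half_cvg : half @ \oo --> \oo.
  move=> A [k _ kA]; exists k.*2 => // n /= kn; apply: kA => /=.
  by move: kn; clear; lia.
have cvg0 : B * ((N./2)%:R ^+ 4 * r ^+ N./2) @[N --> \oo] --> 0.
  have h := cvg_monomial_geometric 4 (ltW r0) r1.
  rewrite -[X in _ --> X](mulr0 B); apply: cvgMr.
  by have := @cvg_comp _ _ _ half _ _ _ _ half_cvg h.
apply/cvgrPdist_lt => eps eps0; near=> N; rewrite distrC.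
apply: le_lt_trans (main N _) _; first by near: N; exists 2%N.
apply: le_lt_trans (ler_norm _) _; rewrite -normrN -sub0r.
by near: N; move/cvgrPdist_lt : cvg0; apply.
Unshelve. all: by end_near.
Qed.
End IntervalsUnion.

(** * The Sylvester equation in eigenbases *)

(** The case of a polynomial in the variable alone is the hypothesis, and the
    property is stable under sums and products. *)
Lemma horner_mx_intertwine (F : fieldType) k (P A D : 'M[F]_k.+1) (q : {poly F}) :
  P *m A = D *m P -> P *m horner_mx A q = horner_mx D q *m P.
Proof.
move=> PA; elim/poly_ind: q => [|q c IH].
  by rewrite !rmorph0 mulmx0 mul0mx.
rewrite !rmorphD !rmorphM /= !horner_mx_X !horner_mx_C mulmxDr mulmxDl.
rewrite -!mulmxE mulmxA IH -[horner_mx D q *m D *m P]mulmxA -PA scalar_mxC.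
by rewrite mulmxA.
Qed.

Lemma diagonalizable_intertwine (F : fieldType) k (A : 'M[F]_k.+1) :
  diagonalizable A ->
  exists (P : 'M[F]_k.+1) (d : 'rV[F]_k.+1),
    [/\ P \in unitmx, P *m A = diag_mx d *m P & forall j, eigenvalue A (d 0 j)].
Proof.
move=> [P Pu /(similar_diagLR Pu)[d Ad]]; exists P, d.
have PA : P *m A = diag_mx d *m P by rewrite Ad conjVmx // !mulmxA mulmxV // mul1mx.
split=> // j; apply/eigenvalueP; exists (row j P).
  by rewrite -row_mul PA row_mul row_diag_mx -scalemxAl -rowE.
apply/eqP => Pj0.
have : row j (P *m invmx P) 0 j = 1 by rewrite mulmxV // !mxE eqxx.
by rewrite row_mul Pj0 mul0mx mxE => /eqP; rewrite eq_sym oner_eq0.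
Qed.

(** The block matrix is conjugate to the block diagonal matrix of [A] and [B] by
    the unipotent matrix with lower left block [X]; the induction on [q] checks
    the resulting formula for all four blocks at once. *)
Lemma lower_left_horner (R : realType) n m (A : 'M[R[i]]_n.+1) (B : 'M[R[i]]_m.+1)
    (C X : 'M[R[i]]_(m.+1, n.+1)) (q : {poly R[i]}) :
  X *m A - B *m X = C ->
  lower_left (horner_mx (sylvester_block A B C) q)
    = X *m horner_mx A q - horner_mx B q *m X.
Proof.
move=> XC; set H := sylvester_block A B C.
suff -> : horner_mx H q = @block_mx R[i] n.+1 m.+1 n.+1 m.+1 (horner_mx A q) 0
    (X *m horner_mx A q - horner_mx B q *m X) (horner_mx B q).
  by rewrite /lower_left block_mxKdl.
elim/poly_ind: q => [|q c IH].
  rewrite !rmorph0 mulmx0 mul0mx subrr.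
  exact/esym/(@block_mx_const _ n.+1 m.+1 n.+1 m.+1).
rewrite !rmorphD !rmorphM /= !horner_mx_X !horner_mx_C IH -!mulmxE.
have -> : H = @block_mx R[i] n.+1 m.+1 n.+1 m.+1 A 0 C B by [].
rewrite (@mulmx_block _ n.+1 m.+1 n.+1 m.+1 n.+1 m.+1) !mulmx0 !mul0mx !addr0 add0r.
rewrite (@scalar_mx_block _ n.+1 m.+1) (@add_block_mx _ n.+1 m.+1 n.+1 m.+1) !addr0.
congr (@block_mx _ n.+1 m.+1 n.+1 m.+1 _ _ _ _).
rewrite -XC mulmxBr mulmxBl mulmxDr mulmxDl !mulmxA scalar_mxC.
by rewrite addrA subrK opprD addrACA subrr addr0.
Qed.

Section DiagonalizableSylvester.
Context {R : realType} {n m : nat}.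
Context (A : 'M[R[i]]_n.+1) (B : 'M[R[i]]_m.+1) (C : 'M[R[i]]_(m.+1, n.+1)).
Context (P : 'M[R[i]]_n.+1) (d : 'rV[R[i]]_n.+1).
Context (Q : 'M[R[i]]_m.+1) (e : 'rV[R[i]]_m.+1).
Context (Pu : P \in unitmx) (Qu : Q \in unitmx).
Context (PA : P *m A = diag_mx d *m P) (QB : Q *m B = diag_mx e *m Q).

Definition spectral_coords (Y : 'M[R[i]]_(m.+1, n.+1)) := Q *m Y *m invmx P.
Local Notation coords := spectral_coords.

Lemma spectral_coordsK Y : invmx Q *m coords Y *m P = Y.
Proof. by rewrite /coords !mulmxA mulVmx // mul1mx mulmxKV. Qed.

Lemma spectral_coords_poly Y q i j :
  coords (Y *m horner_mx A q - horner_mx B q *m Y) i j =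
  (q.[d 0 j] - q.[e 0 i]) * coords Y i j.
Proof.
have PAq := horner_mx_intertwine q PA; have QBq := horner_mx_intertwine q QB.
have -> : coords (Y *m horner_mx A q - horner_mx B q *m Y) =
    coords Y *m horner_mx (diag_mx d) q - horner_mx (diag_mx e) q *m coords Y.
  have hAE : horner_mx A q = invmx P *m horner_mx (diag_mx d) q *m P.
    by rewrite -mulmxA -PAq mulKmx.
  by rewrite /coords mulmxBr mulmxBl hAE !mulmxA QBq mulmxK.
rewrite !horner_mx_diag mul_mx_diag mul_diag_mx !mxE.
by rewrite [X in X - _]mulrC -mulrBl.
Qed.

Lemma spectral_coords_sylvester Y i j :
  coords (Y *m A - B *m Y) i j = (d 0 j - e 0 i) * coords Y i j.
Proof. by have := spectral_coords_poly Y 'X i j; rewrite !horner_mx_X !hornerX. Qed.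

(** In eigenbases the Sylvester operator is multiplication of the entries by the
    nonzero numbers [d_j - e_i]. *)
Lemma sylvester_unique_solution : (forall i j, d 0 j != e 0 i) ->
  exists2 X, X *m A - B *m X = C & forall Y, Y *m A - B *m Y = C -> Y = X.
Proof.
move=> de.
have inj Y Y' : coords Y = coords Y' -> Y = Y'.
  by move=> h; rewrite -(spectral_coordsK Y) h spectral_coordsK.
pose X :=
  invmx Q *m (\matrix_(i, j) (coords C i j / (d 0 j - e 0 i))) *m P.
exists X => [|Y YC]; apply: inj; apply/matrixP => i j.
  rewrite spectral_coords_sylvester /X /coords !mulmxA mulmxV // mul1mx mulmxK //.
  by rewrite mxE mulrC divfK // subr_eq0.
rewrite {2}/coords /X !mulmxA mulmxV // mul1mx mulmxK // mxE -YC.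
by rewrite spectral_coords_sylvester mulrC mulKf // subr_eq0.
Qed.

(** Splitting [X] along pairs of eigenvectors turns the matrix series into
    finitely many scalar series with fixed matrix coefficients, so that matrix
    convergence follows from convergence at the eigenvalues. *)
Lemma lower_left_horner_decomposition X : X *m A - B *m X = C ->
  exists E : 'I_m.+1 -> 'I_n.+1 -> 'M[R[i]]_(m.+1, n.+1),
    \sum_i \sum_j E i j = X /\
    forall q, lower_left (horner_mx (sylvester_block A B C) q)
      = \sum_i \sum_j (q.[d 0 j] - q.[e 0 i]) *: E i j.
Proof.
move=> XC.
exists (fun i j => invmx Q *m (coords X i j *: delta_mx i j) *m P).
have sumE (a : 'I_m.+1 -> 'I_n.+1 -> R[i]) :
    \sum_i \sum_j a i j *: (invmx Q *m (coords X i j *: delta_mx i j) *m P) =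
    invmx Q *m (\matrix_(i, j) (a i j * coords X i j)) *m P.
  rewrite [X in _ = _ *m X *m _]matrix_sum_delta mulmx_sumr mulmx_suml.
  apply: eq_bigr => i _; rewrite mulmx_sumr mulmx_suml; apply: eq_bigr => j _.
  by rewrite mxE -scalerA -[in RHS]scalemxAr -[in RHS]scalemxAl.
split=> [|q].
  have := sumE (fun _ _ => 1); under eq_bigr => i _ do
    under eq_bigr => j _ do rewrite scale1r.
  move=> ->; rewrite -[RHS]spectral_coordsK; congr (_ *m _ *m _).
  by apply/matrixP => i j; rewrite mxE mul1r.
rewrite (lower_left_horner _ XC) sumE -[LHS]spectral_coordsK.
congr (_ *m _ *m _); apply/matrixP => i j.
by rewrite mxE spectral_coords_poly.
Qed.
End DiagonalizableSylvester.

Lemma cvg_real_complex (R : realType) (u : nat -> R) (l : R) :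
  u @ \oo --> l -> (u k)%:C @[k --> \oo] --> l%:C.
Proof.
move=> ul; apply/cvgrPdist_lt => -[a b]; rewrite ltcE /= => /andP[/eqP -> a0].
near=> k; rewrite -rmorphB normc_def /= expr0n /= addr0 sqrtr_sqr ltcR.
by near: k; move/cvgrPdist_lt : ul; apply.
Unshelve. all: by end_near.
Qed.

(** * The sign function on the real axis *)

Lemma direction_inv (R : realType) (theta : R) :
  (direction theta)^-1 = cos theta -i* sin theta.
Proof.
by rewrite /direction {1}/GRing.inv /= cos2Dsin2 !divr1.
Qed.

Lemma direction_neq0 (R : realType) (theta : R) : direction theta != 0.
Proof.
by rewrite -normr_eq0 normc_def /= cos2Dsin2 sqrtr1 oner_eq0.
Qed.

Lemma im_direction_affine (R : realType) (alpha : R[i]) (theta : R) :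
  exists k : R, forall x : R,
    complex.Im ((x%:C - alpha) / direction theta) = k - sin theta * x.
Proof.
case: alpha => a b; exists (sin theta * a - cos theta * b) => x.
by rewrite direction_inv /=; ring.
Qed.

(** On the real axis, membership in a half-plane is the sign of a real affine
    function.  It is not constant, as it has opposite signs at [xa] and [xb], so
    it vanishes at a single [x0], which lies on the line and hence not in [S]. *)
Lemma sign_real_axis (R : realType) (alpha : R[i]) (theta : R) (side : bool)
    (sgn : R[i] -> R) (S : set R) (xa xb : R) :
  (forall z, half_plane alpha theta side z -> sgn z = 1) ->
  (forall z, half_plane alpha theta (~~ side) z -> sgn z = -1) ->
  line alpha theta `&` [set x%:C | x in S] = set0 ->
  half_plane alpha theta side xa%:C -> half_plane alpha theta (~~ side) xb%:C ->
  exists x0 s : R, [/\ ~ S x0, `|s| = 1 &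
    forall t, S t -> sgn t%:C = if x0 < t then s else - s].
Proof.
move=> sgnA sgnB XiS; have [k kE] := im_direction_affine alpha theta.
have epsN : (-1) ^+ (~~ side) = - (-1) ^+ side :> R by rewrite signrN.
move: sgnA sgnB; rewrite /half_plane /= => sgnA sgnB.
rewrite epsN !kE; set eps := (-1) ^+ side; set b := sin theta => ha hb.
have b0 : b != 0.
  apply/eqP => b0; move: ha hb; rewrite b0 !mul0r !subr0; lra.
pose x0 := k / b.
have lE t : k - b * t = - b * (t - x0) by rewrite /x0; field.
have nS : ~ S x0.
  move=> Sx0.
  suff : (line alpha theta `&` [set x%:C | x in S]) x0%:C by rewrite XiS.
  split; last by exists x0.
  pose y := (x0%:C - alpha) / direction theta.
  exists (complex.Re y) => //.
  have -> : (complex.Re y)%:C = y.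
    by rewrite [RHS]complexE kE lE subrr mulr0 mulr0 addr0.
  by rewrite /y mulrC divfK ?direction_neq0 // addrC subrK.
have cA t : 0 < eps * (- b * (t - x0)) -> sgn t%:C = 1.
  by move=> h; apply: sgnA; rewrite kE lE.
have cB t : 0 < - (eps * (- b * (t - x0))) -> sgn t%:C = -1.
  by move=> h; apply: sgnB; rewrite epsN kE lE mulNr.
have eb0 : eps * b != 0 by rewrite mulf_neq0 // signr_eq0.
case: (ltgtP (eps * b) 0) eb0 => // eb _.
- exists x0, 1; split=> //; first exact: normr1.
  move=> t St; case: ltP => h; first by apply: cA; nra.
  apply: cB; have : t != x0 by apply/eqP => e; apply: nS; rewrite -e.
  by move: h; rewrite le_eqVlt => /orP[->//|h] _; nra.
- exists x0, (-1); split=> //; first by rewrite normrN1.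
  move=> t St; case: ltP => h; first by apply: cB; nra.
  rewrite opprK; apply: cA; have : t != x0 by apply/eqP => e; apply: nS; rewrite -e.
  by move: h; rewrite le_eqVlt => /orP[->//|h] _; nra.
Qed.

Theorem theorem3p1 (R : realType) (n m : nat)
    (A : 'M[R[i]]_n.+1) (B : 'M[R[i]]_m.+1) (C : 'M[R[i]]_(m.+1, n.+1))
    (alpha : R[i]) (theta : R) (side : bool) (sgn : R[i] -> R)
    (g : nat) (beta gamma : 'I_g.+1 -> R) (w : R -> R) (p : nat -> {poly R})
    (A_diag : diagonalizable A) (B_diag : diagonalizable B)
    (HA : spectrum A `<=` half_plane alpha theta side)
    (HB : spectrum B `<=` half_plane alpha theta (~~ side))
    (sgnA : forall z, half_plane alpha theta side z -> sgn z = 1)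
    (sgnB : forall z, half_plane alpha theta (~~ side) z -> sgn z = -1)
    (beta_lt_gamma : forall j, beta j < gamma j)
    (disjoint_intervals :
      trivIset [set: 'I_g.+1] (fun j => `[beta j, gamma j]%classic))
    (Xi_Sigma : line alpha theta `&`
      [set x%:C | x in intervals_union beta gamma] = set0)
    (SigmaA : spectrum A `<=` [set x%:C | x in (intervals_union beta gamma)°])
    (SigmaB : spectrum B `<=` [set x%:C | x in (intervals_union beta gamma)°])
    (w_adm : admissible_weight beta gamma w)
    (p_orth : orthonormal_polynomials (intervals_union beta gamma) w p) :
  let H := sylvester_block A B C in
  let coef := sign_coef (intervals_union beta gamma) w p sgn in
  let partial_sums :=
    series (fun j => (coef j)%:C *: lower_left (eval_poly_mx (p j) H)) in
  exists X : 'M[R[i]]_(m.+1, n.+1),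
    [/\ X *m A - B *m X = C,
        forall Y : 'M[R[i]]_(m.+1, n.+1), Y *m A - B *m Y = C -> Y = X,
        cvgn partial_sums &
        X = 2^-1 *: limn partial_sums].
Proof.
move=> H coef partial_sums.
set S := intervals_union beta gamma in SigmaA SigmaB p_orth Xi_Sigma *.
have [P [d [Pu PA eigA]]] := diagonalizable_intertwine A_diag.
have [Q [e [Qu QB eigB]]] := diagonalizable_intertwine B_diag.
have [xa xaS xaE] : exists2 xa : 'I_n.+1 -> R,
    forall j, S° (xa j) & forall j, (xa j)%:C = d 0 j.
  have : forall j, exists x : R, S° x /\ x%:C = d 0 j.
    by move=> j; have [x Sx xE] := SigmaA _ (eigA j); exists x.
  by move=> /choice[f fE]; exists f => j; have [] := fE j.
have [xb xbS xbE] : exists2 xb : 'I_m.+1 -> R,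
    forall i, S° (xb i) & forall i, (xb i)%:C = e 0 i.
  have : forall i, exists x : R, S° x /\ x%:C = e 0 i.
    by move=> i; have [x Sx xE] := SigmaB _ (eigB i); exists x.
  by move=> /choice[f fE]; exists f => i; have [] := fE i.
have sgnd j : sgn (d 0 j) = 1 by apply/sgnA/HA/eigA.
have sgne i : sgn (e 0 i) = -1 by apply/sgnB/HB/eigB.
have de i j : d 0 j != e 0 i.
  apply/eqP => h; have := sgnd j; rewrite h sgne => /eqP.
  by rewrite lt_eqF // (@lt_trans _ _ 0) ?ltrN10.
have [x0 [s [nS s1 sE]]] : exists x0 s : R, [/\ ~ S x0, `|s| = 1 &
    forall t, S t -> sgn t%:C = if x0 < t then s else - s].
  apply: (sign_real_axis (xa := xa ord0) (xb := xb ord0) sgnA sgnB Xi_Sigma).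
    by rewrite xaE; apply: HA; exact: eigA.
  by rewrite xbE; apply: HB; exact: eigB.
have cvg_at x : S° x ->
    \sum_(k < N) coef k * (p k).[x] @[N --> \oo] --> sgn x%:C.
  exact: (sign_expansion_cvg w_adm p_orth nS s1 sE).
have [X XC Xuniq] := sylvester_unique_solution C Pu Qu PA QB de.
have [E [sumE lowE]] := lower_left_horner_decomposition Pu Qu PA QB XC.
pose c i j N :=
  \sum_(k < N) coef k * (p k).[xa j] - \sum_(k < N) coef k * (p k).[xb i].
have lowp k : lower_left (eval_poly_mx (p k) H) =
    \sum_i \sum_j ((p k).[xa j] - (p k).[xb i])%:C *: E i j.
  rewrite [LHS]lowE; apply: eq_bigr => i _; apply: eq_bigr => j _.
  by rewrite -xaE -xbE !horner_map rmorphB.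
have psE N : partial_sums N = \sum_i \sum_j (c i j N)%:C *: E i j.
  rewrite /partial_sums /series /= big_mkord.
  under [LHS] eq_bigr => k _.
    rewrite lowp scaler_sumr.
    under eq_bigr => i _ do rewrite scaler_sumr.
    over.
  rewrite exchange_big; apply: eq_bigr => i _.
  rewrite exchange_big; apply: eq_bigr => j _.
  under eq_bigr => k _ do rewrite scalerA.
  rewrite -scaler_suml; congr (_ *: _).
  rewrite /c -sumrB rmorph_sum; apply: eq_bigr => k _.
  by rewrite -mulrBr rmorphM.
have c2 i j : (c i j N)%:C @[N --> \oo] --> (2%:R : R[i]).
  have -> : (2%:R : R[i]) = (sgn (xa j)%:C - sgn (xb i)%:C)%:C.
    by rewrite xaE xbE sgnd sgne opprK rmorphD rmorph1.
  apply: cvg_real_complex.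
  by apply: cvgB; exact: cvg_at.
have cvgX : partial_sums @ \oo --> 2%:R *: X.
  have -> : partial_sums = (fun N => \sum_i \sum_j (c i j N)%:C *: E i j).
    exact/funext.
  rewrite -sumE scaler_sumr; apply: cvg_big => [|i _]; first exact: add_continuous.
  rewrite scaler_sumr; apply: cvg_big => [|j _]; first exact: add_continuous.
  exact: cvgZr_tmp (c2 i j).
exists X; split; [exact: XC | exact: Xuniq | exact: cvgP cvgX |].
have -> : limn partial_sums = 2%:R *: X by exact: norm_cvg_lim cvgX.
by rewrite scalerA mulVf ?scale1r // pnatr_eq0.
Qed.
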